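(* If $G$ is a singleton-partition graph of order $n$ with $\delta(G)=2$ that contains no full vertex, then $L_{\rm SCC}(G)=\infty$ or $L_{\rm SCC}(G)\le 5$.
   Context: All graphs are finite and simple. A full vertex is a vertex adjacent to all other vertices. A set $D\subseteq V$ is dominating if every vertex not in $D$ has a neighbor in $D$. Two disjoint sets $A,B\subseteq V$ form a coalition if neither is dominating but $A\cup B$ is. A coalition partition of $G$ is a partition $\mathcal{P}$ of $V$ such that every member is either a dominating set of cardinality 1, or is not dominating and forms a coalition with some other member. The coalition graph ${\rm CG}(G,\mathcal{P})$ has vertex set $\mathcal{P}$, two members adjacent iff they form a coalition. $\Gamma_1$ is the partition of $V$ into singletons; $G$ is a singleton-partition graph (SP-graph) if $\Gamma_1$ is a coalition partition of $G$. A singleton coalition graph chain with initial graph $G_1$ is a sequence $G_1\to G_2\to\cdots$ where each graph having a successor is an SP-graph and its successor is ${\rm CG}(G_i,\Gamma_1)$ (up to isomorphism). The $G$-SC chain is such a chain starting at $G$ of maximum possible length (it continues as long as the current graph is an SP-graph; it is infinite if this never fails). Its length $L_{\rm SCC}(G)$ is $k-1$ for a chain $G_1\to\cdots\to G_k$ and $\infty$ for an infinite chain, with the convention that if all graphs in the chain are isomorphic the length is $0$. *)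

(* Defs.v *)
(* Plain MathComp; Stdlib's epsilon only selects the value of [L_SCC]. *)
From Stdlib Require Import Classical ClassicalEpsilon.
From mathcomp Require Import all_boot.

Set Implicit Arguments.
Unset Strict Implicit.
Unset Printing Implicit Defensive.

Record sgraph := SGraph {
  vertex :> finType;
  adj : rel vertex;
  adj_sym : symmetric adj;
  adj_irrefl : irreflexive adj }.

Definition isomorphic (G H : sgraph) : Prop :=
  exists2 f : G -> H, bijective f & forall x y, adj (f x) (f y) = adj x y.

Section Graph.
Variable G : sgraph.
Implicit Types (x y : G) (A B D : {set G}) (P : {set {set G}}).

Definition degree x : nat := #|[set y | adj x y]|.

(* The neutral value #|G| exceeds every degree, so it is never attained
   unless G has no vertex. *)
Definition min_degree : nat := \big[minn/#|G|]_(x : G) degree x.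

Definition full_vertex x : bool := [forall y, (y != x) ==> adj x y].

Definition dominating D : bool :=
  [forall x, (x \notin D) ==> [exists y in D, adj x y]].

Definition coalition A B : bool :=
  [&& [disjoint A & B], ~~ dominating A, ~~ dominating B
    & dominating (A :|: B)].

Definition coalition_partition P : bool :=
  partition P [set: G] &&
  [forall A in P,
     (dominating A && (#|A| == 1)) ||
     (~~ dominating A && [exists B in P :\ A, coalition A B])].

Lemma coalition_sym : symmetric coalition.
Proof.
move=> A B; rewrite /coalition disjoint_sym setUC.
by case: (dominating A); case: (dominating B).
Qed.

Lemma coalition_irrefl : irreflexive coalition.
Proof. by move=> A; rewrite /coalition setUid; case: (dominating A); rewrite !andbF. Qed.

Section CoalitionGraph.
Variable P : {set {set G}}.
Let cg_adj : rel {A : {set G} | A \in P} := fun X Y => coalition (val X) (val Y).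

Let cg_adj_sym : symmetric cg_adj.
Proof. by move=> X Y; apply: coalition_sym. Qed.

Let cg_adj_irrefl : irreflexive cg_adj.
Proof. by move=> X; apply: coalition_irrefl. Qed.

Definition CG : sgraph := SGraph cg_adj_sym cg_adj_irrefl.
End CoalitionGraph.

Definition Gamma1 : {set {set G}} := [set [set x] | x : G].

Definition SP_graph : bool := coalition_partition Gamma1.

End Graph.

Definition SC_successor (G H : sgraph) : Prop :=
  SP_graph G /\ isomorphic H (CG (Gamma1 G)).

Inductive enat := Fin of nat | Infty.

Definition le_enat (k l : enat) : bool :=
  match k, l with
  | Fin i, Fin j => i <= j
  | _, Infty => true
  | Infty, Fin _ => false
  end.

(* [g] and [l] describe the chain g 0 -> g 1 -> ... of maximum possible length
   starting at G: its members are the g i with i <= l, so a finite chain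
   with l = Fin m has k = m.+1 members; values of g beyond l are irrelevant. *)
Definition maximal_SC_chain (G : sgraph) (g : nat -> sgraph) (l : enat) : Prop :=
  [/\ g 0 = G,
      forall i, le_enat (Fin i.+1) l -> SC_successor (g i) (g i.+1)
    & forall m, l = Fin m -> ~~ SP_graph (g m)].

Definition all_isomorphic (g : nat -> sgraph) (l : enat) : Prop :=
  forall i j, le_enat (Fin i) l -> le_enat (Fin j) l -> isomorphic (g i) (g j).

Definition SCC_length (G : sgraph) (L : enat) : Prop :=
  exists g l, maximal_SC_chain G g l /\
    ((all_isomorphic g l /\ L = Fin 0) \/ (~ all_isomorphic g l /\ L = l)).

(* [SCC_length G] holds of exactly one value: see [SCC_length_exists] and
   [SCC_length_unique]. *)
Definition L_SCC (G : sgraph) : enat := epsilon (inhabits Infty) (SCC_length G).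

Lemma isomorphic_refl G : isomorphic G G.
Proof. by exists id => //; exists id. Qed.

Lemma isomorphic_sym G H : isomorphic G H -> isomorphic H G.
Proof.
case=> f [f' fK f'K] fE; exists f'; first by exists f.
by move=> x y; rewrite -fE !f'K.
Qed.

Lemma isomorphic_trans G H K : isomorphic G H -> isomorphic H K -> isomorphic G K.
Proof.
case=> f bf fE [h bh hE]; exists (h \o f); first exact: bij_comp.
by move=> x y /=; rewrite hE fE.
Qed.

Section Transfer.
Variables (G H : sgraph) (f : G -> H) (f' : H -> G).
Hypotheses (fK : cancel f f') (f'K : cancel f' f).
Hypothesis fE : forall x y, adj (f x) (f y) = adj x y.

Let f_inj : injective f := can_inj fK.

Lemma dominating_imset (D : {set G}) : dominating (f @: D) = dominating D.
Proof.
apply/forallP/forallP => domD x; apply/implyP => xD.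
  have /implyP := domD (f x); rewrite mem_imset // => /(_ xD).
  case/exists_inP => _ /imsetP[y yD ->]; rewrite fE => xy.
  by apply/exists_inP; exists y.
have /implyP := domD (f' x).
rewrite -(mem_imset _ _ f_inj) f'K => /(_ xD) /exists_inP[y yD xy].
apply/exists_inP; exists (f y); first exact: imset_f.
by rewrite -(f'K x) fE.
Qed.

Lemma coalition_imset (A B : {set G}) :
  coalition (f @: A) (f @: B) = coalition A B.
Proof.
rewrite /coalition -imsetU !dominating_imset; congr (_ && _).
by rewrite -!setI_eq0 -imsetI ?imset_eq0 // => x y _ _; apply: f_inj.
Qed.

Lemma Gamma1_imset : Gamma1 H = [set f @: (A : {set G}) | A in Gamma1 G].
Proof.
apply/setP => B; apply/imsetP/imsetP => [[y _ ->]|[_ /imsetP[x _ ->] ->]].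
  by exists [set f' y]; rewrite ?imset_f // imset_set1 f'K.
by exists (f x); rewrite ?imset_set1.
Qed.

Lemma Gamma1_partition (K : sgraph) : partition (Gamma1 K) [set: K].
Proof.
apply/and3P; split.
- apply/eqP/setP => x; rewrite inE; apply/bigcupP.
  by exists [set x]; rewrite ?imset_f ?inE.
- apply/trivIsetP => _ _ /imsetP[x _ ->] /imsetP[y _ ->] xy.
  by rewrite disjoints1 inE; apply: contra xy => /eqP->.
- by apply/imsetP => -[x _ /setP/(_ x)]; rewrite !inE eqxx.
Qed.

Lemma SP_graph_transfer : SP_graph G -> SP_graph H.
Proof.
rewrite /SP_graph /coalition_partition !Gamma1_partition /= => /forall_inP spG.
apply/forall_inP => B; rewrite Gamma1_imset => /imsetP[A AP ->].
rewrite dominating_imset card_imset //.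
case/orP: (spG A AP) => [-> //|/andP[-> /exists_inP[C]]] /=.
rewrite !inE => /andP[CA CP] cAC; apply/orP; right.
apply/exists_inP; exists (f @: C); last by rewrite coalition_imset.
by rewrite !inE (inj_eq (imset_inj f_inj)) CA imset_f.
Qed.

End Transfer.

Lemma SP_graph_iso G H : isomorphic G H -> SP_graph G = SP_graph H.
Proof.
move=> iGH; apply/idP/idP.
  by case: iGH => f [f' fK f'K] fE; apply: (SP_graph_transfer fK f'K).
by case: (isomorphic_sym iGH) => f [f' fK f'K] fE; apply: (SP_graph_transfer fK f'K).
Qed.

Lemma CG_Gamma1_iso G H :
  isomorphic G H -> isomorphic (CG (Gamma1 G)) (CG (Gamma1 H)).
Proof.
case=> f [f' fK f'K] fE.
have memf (A : CG (Gamma1 G)) : f @: val A \in Gamma1 H.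
  by rewrite (Gamma1_imset f'K) imset_f ?(valP A).
have memf' (A : CG (Gamma1 H)) : f' @: val A \in Gamma1 G.
  by rewrite (Gamma1_imset fK) imset_f ?(valP A).
pose F (A : CG (Gamma1 G)) : CG (Gamma1 H) := Sub (f @: val A) (memf A).
pose F' (A : CG (Gamma1 H)) : CG (Gamma1 G) := Sub (f' @: val A) (memf' A).
exists F.
  exists F' => A; apply: val_inj; rewrite /F /F' !SubK -imset_comp.
    by rewrite (eq_imset _ fK) imset_id.
  by rewrite (eq_imset _ f'K) imset_id.
by move=> A B; apply: (coalition_imset fK f'K fE).
Qed.

Lemma SCC_length_exists G : exists L, SCC_length G L.
Proof.
pose g i := iter i (fun H => CG (Gamma1 H)) G.
suff [l ml] : exists l, maximal_SC_chain G g l.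
  case: (classic (all_isomorphic g l)) => Hl.
    by exists (Fin 0), g, l; split=> //; left.
  by exists l, g, l; split=> //; right.
have succ i : SP_graph (g i) -> SC_successor (g i) (g i.+1).
  by move=> spi; split=> //; apply: isomorphic_refl.
case: (classic (exists i, ~~ SP_graph (g i))) => [ex|nex].
  case: (ex_minnP ex) => m nspm minm; exists (Fin m); split=> //.
    move=> i /= lt_im; apply: succ; apply: contraLR lt_im => /minm.
    by rewrite -leqNgt.
  by move=> _ [<-].
exists Infty; split=> // i _; apply: succ.
by apply/negPn/negP => nsp; apply: nex; exists i.
Qed.

Lemma maximal_SC_chain_iso G g l h m i :
  maximal_SC_chain G g l -> maximal_SC_chain G h m ->
  le_enat (Fin i) l -> le_enat (Fin i) m -> isomorphic (g i) (h i).
Proof.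
move=> [g0 gS _] [h0 hS _]; elim: i => [|i IH] li mi.
  by rewrite g0 h0; apply: isomorphic_refl.
have [_ ig] := gS _ li; have [_ ih] := hS _ mi.
have le_pred k : le_enat (Fin i.+1) k -> le_enat (Fin i) k by case: k => //= n /ltnW.
apply: isomorphic_trans ig _; apply: isomorphic_trans (isomorphic_sym ih).
by apply: CG_Gamma1_iso; apply: IH; apply: le_pred.
Qed.

Lemma maximal_SC_chain_length G g l h m :
  maximal_SC_chain G g l -> maximal_SC_chain G h m -> le_enat m l.
Proof.
move=> cg ch; case: l cg => [a|] cg; last by case: m ch.
apply/negPn/negP => lm.
have am : le_enat (Fin a.+1) m by case: m lm {ch} => //= b; rewrite -ltnNge.
have am' : le_enat (Fin a) m by case: m am {lm ch} => //= b /ltnW.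
have igh := maximal_SC_chain_iso cg ch (leqnn a : le_enat (Fin a) (Fin a)) am'.
have [_ _ /(_ a erefl)] := cg; rewrite (SP_graph_iso igh).
by have [_ /(_ a am)[-> _] _] := ch.
Qed.

Lemma le_enat_anti k l : le_enat k l -> le_enat l k -> k = l.
Proof. by case: k l => [i|] [j|] //= ij ji; congr Fin; apply/eqP; rewrite eqn_leq ij. Qed.

Lemma SCC_length_unique G L L' : SCC_length G L -> SCC_length G L' -> L = L'.
Proof.
move=> [g [l [cg Lg]]] [h [m [ch Lh]]].
have lm : l = m.
  by apply: le_enat_anti; [apply: (maximal_SC_chain_length ch cg)
                          |apply: (maximal_SC_chain_length cg ch)].
subst m.
have tr g1 g2 : maximal_SC_chain G g1 l -> maximal_SC_chain G g2 l ->
    all_isomorphic g1 l -> all_isomorphic g2 l.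
  move=> c1 c2 a1 i j li lj.
  apply: isomorphic_trans (maximal_SC_chain_iso c2 c1 li li) _.
  apply: isomorphic_trans (a1 i j li lj) _.
  exact: (maximal_SC_chain_iso c1 c2 lj lj).
case: Lg => -[ag ->]; case: Lh => -[ah ->] //.
  by case: ah; apply: tr ag.
by case: ag; apply: tr ah.
Qed.

Lemma L_SCCP G : SCC_length G (L_SCC G).
Proof. exact: (epsilon_spec _ _ (SCC_length_exists G)). Qed.

(* Main.v *)
(* Record the chain on one vertex set, each step replacing the adjacency
   relation e by [coal e].  For at most five vertices all graphs are tested by
   computation.  Otherwise let K = N[v] with deg v = 2, and R its complement, so
   |R| >= 3.  Every coalition must dominate v, so R is independent in the first
   successor, and then in all later ones.  Since |R| >= 3, the successor of a
   graph with a full vertex is not an SP-graph, so the first terms have no full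
   vertices; this forces the first successor to be the complete bipartite graph
   on K and R, which is its own successor. *)
From Stdlib Require Import Classical.
Require Import Defs.
From mathcomp Require Import all_boot.

Set Implicit Arguments.
Unset Strict Implicit.
Unset Printing Implicit Defensive.

(** * Singleton coalitions as a relation on a fixed vertex set *)

Section Relations.
Variable T : finType.
Implicit Types (e : rel T) (x y z r : T).

Definition full e x : bool := [forall y, (y != x) ==> e x y].

Definition covers e x y : bool :=
  [forall z, [|| z == x, z == y, e x z | e y z]].

(** For symmetric [e] this is the coalition of two singletons: a singleton dominates iff its vertex
    is full, and [covers] says that the pair dominates. *)
Definition coal e : rel T :=
  fun x y => [&& x != y, ~~ full e x, ~~ full e y & covers e x y].

Definition SP_rel e : bool := [forall x, full e x || [exists y, coal e x y]].

Lemma coal_sym e : symmetric (coal e).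
Proof.
move=> x y; rewrite /coal eq_sym; congr (_ && _).
rewrite andbCA; congr [&& _, _ & _]; apply: eq_forallb => z.
by rewrite orbCA; congr [|| _, _ | _]; rewrite orbC.
Qed.

Lemma coal_irrefl e : irreflexive (coal e).
Proof. by move=> x; rewrite /coal eqxx. Qed.

Lemma eq_full e e' : e =2 e' -> full e =1 full e'.
Proof. by move=> ee' x; apply: eq_forallb => y; rewrite ee'. Qed.

Lemma eq_coal e e' : e =2 e' -> coal e =2 coal e'.
Proof.
move=> ee' x y; rewrite /coal !(eq_full ee'); congr [&& _, _, _ & _].
by apply: eq_forallb => z; rewrite !ee'.
Qed.

Lemma eq_SP_rel e e' : e =2 e' -> SP_rel e = SP_rel e'.
Proof.
move=> ee'; apply: eq_forallb => x; rewrite (eq_full ee'); congr (_ || _).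
by apply: eq_existsb => y; rewrite (eq_coal ee').
Qed.

Lemma eq_iter_coal k e e' : e =2 e' -> iter k coal e =2 iter k coal e'.
Proof. by move=> ee'; elim: k => //= k IH; apply: eq_coal. Qed.

Lemma coalP {e x y} :
  coal e x y -> forall z, [|| z == x, z == y, e x z | e y z].
Proof. by case/and4P => _ _ _ /forallP. Qed.

Lemma SP_rel_coal e x : SP_rel e -> ~~ full e x -> exists y, coal e x y.
Proof. by move=> /forallP/(_ x) /orP[->//|/existsP]. Qed.

(** Periodicity lowers an index of at least [k + p] by [p], so strong induction reaches the range
    covered by the hypothesis. *)
Lemma SP_rel_periodic e k p :
  0 < p -> iter (k + p) coal e =2 iter k coal e ->
  (forall i, i < k + p -> SP_rel (iter i coal e)) ->
  forall i, SP_rel (iter i coal e).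
Proof.
move=> p0 per SPlt; elim/ltn_ind => i IH.
case: (ltnP i (k + p)) => [/SPlt //|le_i].
have -> : i = (i - (k + p)) + (k + p) by rewrite subnK.
rewrite iterD (eq_SP_rel (eq_iter_coal _ per)) -iterD; apply: IH.
by rewrite -{2}(subnK le_i) addnA -[X in X < _]addn0 ltn_add2l.
Qed.

End Relations.

(** * Graphs in which the complement R of a three-element set K is independent *)

Section LargeOrder.
Variables (T : finType) (K : {set T}).
Hypotheses (card_K : #|K| = 3) (card_R : 3 <= #|~: K|).
Implicit Types (e : rel T) (x y r s p q : T).

Definition indep_R e : Prop := forall x y, x \notin K -> y \notin K -> ~~ e x y.

Definition complete_R e x : Prop := forall r, r \notin K -> e x r.

(** Removing two vertices cannot exhaust R, which has at least three. *)
Lemma R_avoid x y : exists r, [/\ r \notin K, r != x & r != y].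
Proof.
have : 0 < #|~: K :\ x :\ y|.
  move: card_R; rewrite (cardsD1 x) (cardsD1 y (_ :\ x)).
  by case: (x \in _); case: (y \in _); case: #|_|.
case/card_gt0P => r; rewrite !inE => /and3P[ry rx rK].
by exists r.
Qed.

Lemma K_other s : s \in K -> exists2 p, p \in K & p != s.
Proof.
move=> sK; have : 0 < #|K :\ s| by move: card_K; rewrite (cardsD1 s) sK; case: #|_|.
by case/card_gt0P => p; rewrite !inE => /andP[ps pK]; exists p.
Qed.

Lemma K_third s s' : s \in K -> s' \in K -> s != s' ->
  exists p, [/\ p \in K, p != s, p != s'
    & forall x, x \in K -> [|| x == s, x == s' | x == p]].
Proof.
move=> sK s'K ss'; have : #|K :\ s :\ s'| = 1.
  move: card_K; rewrite (cardsD1 s) (cardsD1 s' (_ :\ s)).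
  by rewrite !inE eq_sym ss' s'K sK => -[].
move/eqP/cards1P => [p Kp]; exists p.
have /setP/(_ p) := Kp; rewrite !inE eqxx => /and3P[ps' ps pK]; split=> // x xK.
by have /setP/(_ x) := Kp; rewrite !inE xK andbT; do 2!case: eqP.
Qed.

(** Two vertices of R cannot cover a third one, as they have no neighbor in R. *)
Lemma coal_indep_R e : indep_R e -> indep_R (coal e).
Proof.
move=> ind x y xR yR; apply/negP => /coalP c.
have [r [rR rx ry]] := R_avoid x y.
by have := c r; rewrite (negPf rx) (negPf ry) !(negPf (ind _ _ _ _)).
Qed.

Lemma indep_R_not_full e r : indep_R e -> r \notin K -> ~~ full e r.
Proof.
move=> ind rR; have [r' [r'R r'r _]] := R_avoid r r.
apply/negP => /forallP/(_ r'); rewrite r'r /=; apply/negP.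
exact: ind.
Qed.

(** A full [x] is isolated in [coal e]. A vertex r of R needs a partner that covers [x] there, which
    can only be [x] itself; but then another vertex of R stays uncovered. *)
Lemma full_not_SP_coal e x :
  indep_R (coal e) -> full e x -> ~~ SP_rel (coal e).
Proof.
move=> ind fx; apply/negP => SPe.
have isol y : coal e x y = false by rewrite /coal fx andbF.
have isol' y : coal e y x = false by rewrite coal_sym isol.
have [r [rR rx _]] := R_avoid x x; have [r' [r'R r'x r'r]] := R_avoid x r.
have [y /coalP c] := SP_rel_coal SPe (indep_R_not_full ind rR).
have := c x; rewrite !isol' eq_sym (negPf rx) /= orbF => /eqP xy.
have := c r'; rewrite (negPf r'r) -xy (negPf r'x) isol /=.
by rewrite (negPf (ind _ _ rR r'R)).
Qed.

(** As R is independent, the coalition with [r1] forces [x] to be adjacent to all of R but [r1], and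
    the one with [r2] supplies [r1]. *)
Lemma coal_complete_R e x r1 r2 : indep_R e -> x \in K ->
  r1 \notin K -> r2 \notin K -> r1 != r2 ->
  coal e x r1 -> coal e x r2 -> complete_R e x.
Proof.
move=> ind xK r1R r2R r12 c1 c2 y yR.
have yx : y != x by apply: contraNneq yR => ->.
have step r : r \notin K -> y != r -> coal e x r -> e x y.
  move=> rR yr /coalP/(_ y).
  by rewrite (negPf yx) (negPf yr) (negPf (ind _ _ rR yR)) orbF.
have [yr1|] := altP (y =P r1); last by move=> yr1; apply: (step r1).
by apply: (step r2); rewrite // yr1.
Qed.

Lemma not_complete_R_nonadj e s : indep_R e -> s \in K -> ~ complete_R e s ->
  exists2 r, r \notin K & ~~ coal e s r.
Proof.
move=> ind sK nc; have [r [rR _ _]] := R_avoid s s.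
have [r' [r'R r'r _]] := R_avoid r r.
case c: (coal e s r); last by exists r; rewrite ?c.
case c': (coal e s r'); last by exists r'; rewrite ?c'.
by case: nc; apply: (coal_complete_R ind sK rR r'R _ c c'); rewrite eq_sym.
Qed.

(* Every r in R has a partner x in the graph [coal e]; x is joined there to all
   of R but r, so x is complete to R in e.  If only one vertex p of K were
   complete to R, it would be the partner of every r, hence full in [coal e]. *)
Lemma two_complete_R e s s' : symmetric e -> indep_R e ->
  (forall x, ~~ full (coal e) x) -> SP_rel (coal e) ->
  s \in K -> s' \in K -> s != s' ->
  complete_R e s \/ complete_R e s'.
Proof.
move=> sym ind nofull SPe sK s'K ss'.
apply: NNPP => /not_or_and [ncs ncs'].
have [p [pK ps ps' Kall]] := K_third sK s'K ss'.
have ind1 := coal_indep_R ind.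
have partner r : r \notin K -> coal (coal e) p r.
  move=> rR; have [x c] := SP_rel_coal SPe (nofull r).
  have xK : x \in K.
    apply/negPn/negP => xR.
    by move: c; rewrite (negPf (coal_indep_R ind1 rR xR)).
  suff /eqP <- : x == p by rewrite coal_sym.
  have cx : complete_R e x.
    have [r1 [r1R r1r _]] := R_avoid r r.
    have [r2 [r2R r2r r21]] := R_avoid r r1.
    have cxr y : y \notin K -> y != r -> coal e x y.
      move=> yR yr; have yx : y != x by apply: contraNneq yR => ->.
      have := coalP c y.
      by rewrite (negPf yr) (negPf yx) (negPf (ind1 _ _ rR yR)).
    by apply: (coal_complete_R ind xK r1R r2R); rewrite ?cxr // eq_sym.
  by case/or3P: (Kall x xK) => // /eqP xE; [case: ncs | case: ncs']; rewrite -xE.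
(* A nonneighbor [y] of [p] must be covered by each r in R. For [y] in R this contradicts
   independence; for [y] in K it would make [y] complete to R in [e]. *)
have nadj y : ~~ coal e p y -> y != p -> forall r, r \notin K -> y != r ->
    coal e y r.
  move=> py yp r rR yr; have := coalP (partner r rR) y.
  by rewrite (negPf yp) (negPf yr) (negPf py) coal_sym.
case/negP: (nofull p); apply/forallP => y; apply/implyP => yp.
apply/negPn/negP => py.
have [yK|yR] := boolP (y \in K); last first.
  have [r [rR ry _]] := R_avoid y y.
  have := nadj y py yp r rR; rewrite eq_sym => /(_ ry).
  by rewrite (negPf (ind1 _ _ yR rR)).
have ncy : ~ complete_R e y.
  by case/or3P: (Kall y yK) yp => /eqP -> //; rewrite eqxx.
have [r rR] := not_complete_R_nonadj ind yK ncy.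
rewrite (nadj y py yp r rR) //.
by apply: contraNneq rR => <-.
Qed.

(** If [s] in K misses some r in R, another vertex p of K becomes full in [coal e]: p is adjacent to
    all of R, and also to [s], because p and r together cover [s]. *)
Lemma all_complete_R e : symmetric e -> irreflexive e -> indep_R e ->
  (forall i x, i < 3 -> ~~ full (iter i (@coal T) e) x) ->
  SP_rel (coal e) -> SP_rel (coal (coal e)) ->
  forall s, s \in K -> complete_R e s.
Proof.
move=> sym irr ind nofull SP1 SP2 s sK; apply: NNPP => ncs.
have nf0 x := nofull 0 x isT; have nf1 x := nofull 1 x isT.
have nf2 x := nofull 2 x isT; rewrite /= in nf0 nf1 nf2.
have ind1 := coal_indep_R ind.
(* [two_complete_R] is applied to [e] and again to [coal e], where [s] is still not complete to
   R. *)
have compl1 p : p \in K -> p != s -> complete_R e p /\ complete_R (coal e) p.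
  move=> pK ps; split.
    by case: (two_complete_R sym ind nf1 SP1 pK sK ps).
  case: (two_complete_R (coal_sym e) ind1 nf2 SP2 pK sK ps) => // cs.
  have [r rR] := not_complete_R_nonadj ind sK ncs.
  by rewrite cs.
have [r rR nsr] : exists2 r, r \notin K & ~~ e s r.
  apply: NNPP => nex; apply: ncs => r rR; apply/negPn/negP => nsr.
  by apply: nex; exists r.
have adj_s p : p \in K -> p != s -> e p s.
  move=> pK ps; have [_ c1] := compl1 p pK ps.
  have sr : s != r by apply: contraNneq rR => <-.
  have := coalP (c1 r rR) s.
  by rewrite eq_sym (negPf ps) (negPf sr) [e r s]sym (negPf nsr) orbF.
have [p pK ps] := K_other sK.
have [q [qK qp qs Kall]] := K_third pK sK ps.
have [cp c1p] := compl1 p pK ps; have [cq _] := compl1 q qK qs.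
case/negP: (nf1 p); apply/forallP => y; apply/implyP => yp.
have [yK|yR] := boolP (y \in K); last exact: c1p.
(* Here [y] is [q] or [s]. The vertex [p] covers R and [s], while [q] is either [y] itself or
   adjacent to [y = s]. *)
rewrite /coal eq_sym yp !nf0; apply/forallP => z.
have [zK|zR] := boolP (z \in K); last by rewrite cp ?orbT.
case/or3P: (Kall z zK) => /eqP ->; rewrite ?eqxx ?(adj_s p pK ps) ?orbT //.
case/or3P: (Kall y yK) yp => /eqP ->; rewrite ?eqxx ?orbT // => _.
by rewrite [e s q]sym adj_s ?orbT.
Qed.

(** Only the independence of K is left to show. An edge inside K would make the third vertex s of K
    full in [coal e]: s covers R, and any partner covers the rest of K, by that edge or by
    completeness. *)
Lemma complete_bipartite e : symmetric e -> irreflexive e -> indep_R e ->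
  (forall x, ~~ full e x) -> (forall x, ~~ full (coal e) x) ->
  (forall s, s \in K -> complete_R e s) ->
  forall x y, e x y = (x \in K) (+) (y \in K).
Proof.
move=> sym irr ind nf0 nf1 complK.
have Kind p q : p \in K -> q \in K -> ~~ e p q.
  move=> pK qK; apply/negP => epq.
  have eqp : e q p by rewrite sym.
  have pq : p != q by apply: contraTneq epq => ->; rewrite irr.
  have [s [sK sp sq Kall]] := K_third pK qK pq.
  case/negP: (nf1 s); apply/forallP => y; apply/implyP => ys.
  rewrite /coal eq_sym ys !nf0; apply/forallP => z.
  have [zK|zR] := boolP (z \in K); last by rewrite complK ?orbT.
  have [yK|yR] := boolP (y \in K); last first.
    by rewrite [e y z]sym (complK z zK y yR) ?orbT.
  case/or3P: (Kall z zK) => /eqP ->; case/or3P: (Kall y yK) ys => /eqP ->;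
    by rewrite ?eqxx ?epq ?eqp ?orbT.
move=> x y; have [xK|xR] := boolP (x \in K); have [yK|yR] := boolP (y \in K).
- exact/negbTE/Kind.
- exact: complK.
- by rewrite sym complK.
- exact/negbTE/ind.
Qed.

(** Both sides have at least three vertices. Hence no vertex is full and two vertices on one side
    miss a third one there, whereas a crossing pair covers everything. *)
Lemma coal_bipartite e : (forall x y, e x y = (x \in K) (+) (y \in K)) ->
  coal e =2 e.
Proof.
move=> eE x y.
have nf z : ~~ full e z.
  apply/negP => /forallP fz; have [zK|zR] := boolP (z \in K).
    have [p pK pz] := K_other zK.
    by have := fz p; rewrite pz eE zK pK.
  have [r [rR rz _]] := R_avoid z z.
  by have := fz r; rewrite rz eE (negPf zR) (negPf rR).
rewrite /coal !nf /= eE; have [-> |xy] := eqVneq x y; first by rewrite addbb.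
have [xK|xR] := boolP (x \in K); have [yK|yR] := boolP (y \in K) => /=.
- apply/negbTE/negP => /forallP c.
  have [s [sK sx sy _]] := K_third xK yK xy.
  by have := c s; rewrite (negPf sx) (negPf sy) !eE xK yK sK.
- by apply/forallP => z; rewrite !eE xK (negPf yR) /=;
    case: (z \in K); rewrite ?orbT.
- by apply/forallP => z; rewrite !eE yK (negPf xR) /=;
    case: (z \in K); rewrite ?orbT.
- apply/negbTE/negP => /forallP c; have [r [rR rx ry]] := R_avoid x y.
  by have := c r; rewrite (negPf rx) (negPf ry) !eE
    (negPf xR) (negPf yR) (negPf rR).
Qed.

End LargeOrder.

Lemma SP_rel_large (T : finType) (e : rel T) (v : T) :
  symmetric e -> irreflexive e -> 5 < #|T| -> #|[set y | e v y]| = 2 ->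
  (forall i, i <= 5 -> SP_rel (iter i (@coal T) e)) ->
  forall i, SP_rel (iter i (@coal T) e).
Proof.
move=> sym irr ltT deg_v SPe; pose K := v |: [set y | e v y].
have card_K : #|K| = 3 by rewrite cardsU1 deg_v inE irr.
have card_R : 3 <= #|~: K| by move: ltT; rewrite -(cardsC K) card_K.
have ind0 : indep_R K (coal e).
  move=> x y; rewrite !inE ![e v _]sym !negb_or => /andP[xv exv] /andP[yv eyv].
  apply/negP => /coalP/(_ v).
  by rewrite eq_sym (negPf xv) eq_sym (negPf yv) (negPf exv) (negPf eyv).
have ind i : indep_R K (iter i.+1 (@coal T) e).
  by elim: i => // i IH; apply: coal_indep_R.
have nofull i x : i < 3 -> ~~ full (iter i (@coal T) (coal e)) x.
  (* A full vertex in term [i + 1] would keep term [i + 2] from being an SP-graph, and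
     [i + 2 <= 4]. *)
  move=> i3; apply/negP; rewrite -iterSr => /(full_not_SP_coal card_R (ind i.+1)).
  by case/negP; apply: (SPe i.+2); apply: leq_trans (_ : 4 <= 5).
have complK := all_complete_R card_K card_R (@coal_sym _ e) (@coal_irrefl _ e)
  ind0 nofull (SPe 2 isT) (SPe 3 isT).
have eE := complete_bipartite card_K (@coal_sym _ e) (@coal_irrefl _ e) ind0
  (fun x => nofull 0 x isT) (fun x => nofull 1 x isT) complK.
(* Term 2 equals term 1, so only terms 0 and 1 remain to be checked. *)
apply: (@SP_rel_periodic _ e 1 1) => //; first exact: coal_bipartite eE.
by move=> i i2; apply: SPe; apply: leq_trans (ltnW i2) _.
Qed.

(** * Exhaustive computation for at most five vertices *)

Section Tables.
Variable n : nat.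
Implicit Types (t : seq (seq bool)) (e : rel 'I_n).

(** Adjacency matrices are nested lists so that the tests evaluate; positions outside the table
    count as nonadjacent. *)
Definition entry t i j : bool := nth false (nth [::] t i) j.

Definition table (f : nat -> nat -> bool) : seq (seq bool) :=
  mkseq (fun i => mkseq (f i) n) n.

Definition table_full t i : bool :=
  all (fun j => (j == i) || entry t i j) (iota 0 n).

Definition table_coal t : seq (seq bool) :=
  table (fun i j => [&& i != j, ~~ table_full t i, ~~ table_full t j
    & all (fun k => [|| k == i, k == j, entry t i k | entry t j k]) (iota 0 n)]).

Definition table_SP t : bool :=
  let c := table_coal t in
  all (fun i => table_full t i || has (entry c i) (iota 0 n)) (iota 0 n).

(* If the first k + 1 terms are SP-graphs, the chain repeats with period two from
   term k on. *)
Fixpoint table_chain_ok k t : bool :=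
  if table_SP t then
    let t1 := table_coal t in
    if k is k'.+1 then table_chain_ok k' t1
    else table_SP t1 && (table_coal t1 == t)
  else true.

(** Each pair is tried as a nonedge and as an edge, so the leaves run through all choices of edges.
    With 5, six initial SP-graphs must force term 6 to be one and term 7 to equal term 5. *)
Fixpoint all_graphs_ok (pairs edges : seq (nat * nat)) : bool :=
  if pairs is p :: pairs' then
    if all_graphs_ok pairs' edges then all_graphs_ok pairs' (p :: edges)
    else false
  else table_chain_ok 5
    (table (fun i j => ((i, j) \in edges) || ((j, i) \in edges))).

Definition represents e t : Prop := forall i j : 'I_n, e i j = entry t i j.

Lemma entry_table f (i j : 'I_n) : entry (table f) i j = f i j.
Proof. by rewrite /entry !nth_mkseq. Qed.

Lemma all_iota_ord (P : pred nat) : [forall i : 'I_n, P i] = all P (iota 0 n).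
Proof.
apply/forallP/allP => [Pi i | Pi i]; last by apply: Pi; rewrite mem_iota /=.
by rewrite mem_iota /= => i_n; apply: (Pi (Ordinal i_n)).
Qed.

Lemma has_iota_ord (P : pred nat) : [exists i : 'I_n, P i] = has P (iota 0 n).
Proof.
apply/existsP/hasP => [[i Pi] | [i]]; first by exists (val i); rewrite ?mem_iota /=.
by rewrite mem_iota /= => i_n Pi; exists (Ordinal i_n).
Qed.

Section Represents.
Variables (e : rel 'I_n) (t : seq (seq bool)).
Hypothesis et : represents e t.

Lemma represents_full (i : 'I_n) : full e i = table_full t i.
Proof.
rewrite /table_full -all_iota_ord; apply: eq_forallb => j.
by rewrite et -val_eqE; case: (_ == _).
Qed.

Lemma represents_coal : represents (coal e) (table_coal t).
Proof.
move=> i j; rewrite entry_table /coal !represents_full -all_iota_ord.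
congr [&& _, _, _ & _]; apply: eq_forallb => k.
by rewrite !et -!val_eqE.
Qed.

Lemma represents_SP : SP_rel e = table_SP t.
Proof.
rewrite /table_SP -all_iota_ord; apply: eq_forallb => i.
rewrite represents_full -has_iota_ord; congr (_ || _).
by apply: eq_existsb => j; rewrite represents_coal.
Qed.

End Represents.

Lemma table_chain_okP k t e : represents e t -> table_chain_ok k t ->
  (forall i, i <= k -> SP_rel (iter i (@coal _) e)) ->
  SP_rel (iter k.+1 (@coal _) e)
    /\ iter (k + 2) (@coal _) e =2 iter k (@coal _) e.
Proof.
elim: k t e => [|k IH] t e et /= + SPe.
  have e1t := represents_coal et; rewrite -(represents_SP et) (SPe 0) //.
  case/andP; rewrite -(represents_SP e1t) => SP1 /eqP tE; split=> // i j.
  by rewrite /= (represents_coal e1t) tE et.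
rewrite -(represents_SP et) (SPe 0) // => ok.
have [|SPk per] := IH _ _ (represents_coal et) ok.
  by move=> i ik; rewrite -iterSr; apply: SPe.
by split=> [|i j]; rewrite -?iterS iterSr // per -iterSr.
Qed.

(** The predicate [a] selects one branch of the search; the conclusion is the test at its leaf,
    where the chosen pairs have accumulated in reverse. *)
Lemma all_graphs_okP (a : pred (nat * nat)) pairs edges :
  all_graphs_ok pairs edges -> all_graphs_ok [::] (catrev (filter a pairs) edges).
Proof.
elim: pairs edges => //= p pairs IH edges.
by case: ifP => // ok ok'; case: (a p); apply: IH.
Qed.

Lemma SP_rel_small e : symmetric e -> irreflexive e ->
  all_graphs_ok [seq (i, j) | i <- iota 0 n, j <- iota i.+1 (n - i.+1)] [::] ->
  (forall i, i <= 5 -> SP_rel (iter i (@coal _) e)) ->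
  forall i, SP_rel (iter i (@coal _) e).
Proof.
move=> sym irr ok SPe.
(* This predicate picks the leaf that carries [e]. *)
pose a (p : nat * nat) :=
  [exists i : 'I_n, exists j : 'I_n, e i j && (p == (val i, val j))].
have aE (i j : 'I_n) : a (val i, val j) = e i j.
  apply/existsP/idP => [[i' /existsP[j' /andP[e' /eqP[ii jj]]]]|eij].
    by rewrite (val_inj ii) (val_inj jj).
  by exists i; apply/existsP; exists j; rewrite eij eqxx.
have := all_graphs_okP a ok; rewrite /all_graphs_ok; set t := table _ => okt.
have et : represents e t.
  move=> i j; rewrite entry_table !catrevE !cats0 !mem_rev !mem_filter.
  rewrite (aE i j) (aE j i).
  (* Each unordered pair is listed once, smaller entry first; symmetry and irreflexivity of [e]
     recover the other entries. *)
  have pairsE (x y : 'I_n) : ((val x, val y) \in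
      [seq (i, j) | i <- iota 0 n, j <- iota i.+1 (n - i.+1)]) = (x < y).
    apply/allpairsPdep/idP => [[x' [y' [_ + [-> ->]]]]|xy].
      by rewrite mem_iota => /andP[].
    exists (val x), (val y); rewrite !mem_iota /= xy; split=> //.
    by rewrite subnKC ?ltn_ord.
  rewrite !pairsE [e j i]sym -andb_orr -neq_ltn.
  have [/val_inj ->|] := eqVneq (val i) (val j); first by rewrite irr.
  by rewrite andbT.
have [SP6 per] := table_chain_okP (k := 5) et okt SPe.
(* Terms 0 to 6 are needed: term 6 is [SP6], the others are assumed. *)
apply: (@SP_rel_periodic _ e 5 2) => // i.
by rewrite /= ltnS leq_eqVlt => /predU1P[-> //|]; apply: SPe.
Qed.

End Tables.

(** The largest case is order five, with 2^10 labelled graphs. *)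
Lemma all_small_graphs_ok n : n <= 5 ->
  all_graphs_ok n [seq (i, j) | i <- iota 0 n, j <- iota i.+1 (n - i.+1)] [::].
Proof. by case: n => [|[|[|[|[|[|n]]]]]] // _; vm_compute. Qed.

(** * Translation between graphs and relations *)

(* The relation e is the adjacency of G read on another vertex type, so that a
   whole chain can be followed on one type. *)
Definition has_rel (T : finType) (G : sgraph) (e : rel T) : Prop :=
  exists2 f : T -> G, bijective f & forall x y, adj (f x) (f y) = e x y.

Lemma dominating1 (G : sgraph) (x : G) : dominating [set x] = full (@adj G) x.
Proof.
apply: eq_forallb => y; rewrite inE; congr (_ ==> _).
apply/exists_inP/idP => [[z /set1P->]|xy]; first by rewrite adj_sym.
by exists x; rewrite ?inE // adj_sym.
Qed.

Lemma coalition1 (G : sgraph) (x y : G) :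
  coalition [set x] [set y] = coal (@adj G) x y.
Proof.
rewrite /coalition !dominating1 disjoints1 inE; congr [&& _, _, _ & _].
apply: eq_forallb => z; rewrite !inE negb_or.
have [//|zx] := eqVneq z x; have [//|zy] := eqVneq z y => /=.
apply/exists_inP/orP => [[w /set2P[]->]|[] xz]; rewrite 1?adj_sym; first by left.
- by right.
- by exists x; rewrite ?inE ?eqxx // adj_sym.
- by exists y; rewrite ?inE ?eqxx ?orbT // adj_sym.
Qed.

Lemma SP_graph_rel (G : sgraph) : SP_graph G = SP_rel (@adj G).
Proof.
rewrite /SP_graph /coalition_partition Gamma1_partition /=.
apply/forall_inP/forallP => SPG.
  move=> x; have := SPG [set x] (imset_f _ isT); rewrite dominating1.
  case: (full _ x) => //= /exists_inP[B]; rewrite !inE => /andP[_].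
  by case/imsetP => y _ ->; rewrite coalition1 => c; apply/existsP; exists y.
move=> _ /imsetP[x _ ->]; rewrite dominating1 cards1.
have := SPG x; case: (full _ x) => //= /existsP[y c].
apply/exists_inP; exists [set y]; last by rewrite coalition1.
rewrite !inE imset_f // andbT; apply: contraTneq c => /set1_inj ->.
by rewrite coal_irrefl.
Qed.

Section HasRel.
Variables (T : finType) (G : sgraph) (e : rel T).
Hypothesis Ge : has_rel G e.

Lemma has_rel_full (f : T -> G) : bijective f ->
  (forall x y, adj (f x) (f y) = e x y) -> forall x, full (@adj G) (f x) = full e x.
Proof.
move=> bf fE x; have [f' fK f'K] := bf.
apply/forallP/forallP => fx y.
  by have := fx (f y); rewrite (inj_eq (bij_inj bf)) fE.
by have := fx (f' y); rewrite -fE f'K -(inj_eq (bij_inj bf)) f'K.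
Qed.

Lemma has_rel_coal_eq (f : T -> G) : bijective f ->
  (forall x y, adj (f x) (f y) = e x y) ->
  forall x y, coal (@adj G) (f x) (f y) = coal e x y.
Proof.
move=> bf fE x y; have [f' fK f'K] := bf.
rewrite /coal (inj_eq (bij_inj bf)) !(has_rel_full bf fE).
congr [&& _, _, _ & _]; apply/forallP/forallP => c z.
  by have := c (f z); rewrite !(inj_eq (bij_inj bf)) !fE.
by have := c (f' z); rewrite -!fE f'K -!(inj_eq (bij_inj bf)) f'K.
Qed.

Lemma has_rel_SP : SP_graph G = SP_rel e.
Proof.
have [f bf fE] := Ge; have [f' fK f'K] := bf.
rewrite SP_graph_rel; apply/forallP/forallP => SPe x.
  have := SPe (f x); rewrite (has_rel_full bf fE) => /orP[->//|/existsP[y c]].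
  apply/orP; right; apply/existsP; exists (f' y).
  by rewrite -(has_rel_coal_eq bf fE) f'K.
rewrite -(f'K x) (has_rel_full bf fE).
have /orP[->//|/existsP[y c]] := SPe (f' x).
by apply/orP; right; apply/existsP; exists (f y); rewrite (has_rel_coal_eq bf fE).
Qed.

(** Sending x to its singleton identifies the vertices of [G] with those of its coalition graph, so
    the successor can again be read on [T]. *)
Lemma has_rel_successor H : SC_successor G H -> has_rel H (coal e).
Proof.
case=> _ /isomorphic_sym[h bh hE]; have [f bf fE] := Ge.
have mem1 (x : G) : [set x] \in Gamma1 G by apply: imset_f.
pose s (x : G) : CG (Gamma1 G) := Sub [set x] (mem1 x).
have bs : bijective s.
  apply: inj_card_bij => [x y /(congr1 val)|]; first exact: set1_inj.
  by rewrite card_sig card_imset //; apply: set1_inj.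
exists (h \o (s \o f)); first by do 2!apply: bij_comp => //.
by move=> x y /=; rewrite hE /= [LHS]coalition1 (has_rel_coal_eq bf fE).
Qed.

End HasRel.

(** * The length of the chain *)

Lemma maximal_SC_chain_rel (T : finType) (G : sgraph) (e : rel T) g m i :
  has_rel G e -> maximal_SC_chain G g (Fin m) -> i <= m ->
  has_rel (g i) (iter i (@coal T) e).
Proof.
move=> Ge [g0 gS _]; elim: i => [|i IH] im; first by rewrite g0.
by rewrite iterS; apply: has_rel_successor (gS i im); apply: IH; apply: ltnW.
Qed.

(** In a finite maximal chain of length above [k], the terms up to index [k] have successors and so
    are SP-graphs. The hypothesis then makes the last term one too, contrary to maximality. *)
Lemma L_SCC_bound (T : finType) (G : sgraph) (e : rel T) k : has_rel G e ->
  ((forall i, i <= k -> SP_rel (iter i (@coal T) e)) ->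
    forall i, SP_rel (iter i (@coal T) e)) ->
  L_SCC G = Infty \/ le_enat (L_SCC G) (Fin k).
Proof.
move=> Ge SPk; have [g [l [ch [[_ ->]|[_ ->]]]]] := L_SCCP G; first by right.
case: l ch => [m|] ch; [right | by left].
apply/negPn/negP; rewrite /= -ltnNge => km.
have hr := maximal_SC_chain_rel Ge ch; have [_ gS /(_ m erefl)] := ch.
rewrite (has_rel_SP (hr m (leqnn m))) SPk // => i ik.
have im := leq_ltn_trans ik km.
by rewrite -(has_rel_SP (hr i (ltnW im))); have [] := gS i im.
Qed.

Lemma min_degree_attained (G : sgraph) :
  min_degree G = #|G| \/ exists x : G, degree x = min_degree G.
Proof.
rewrite /min_degree; elim/big_ind: _ => [|a b Pa Pb|x _]; first by left.
  by rewrite /minn; case: ifP.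
by right; exists x.
Qed.

Unset Implicit Arguments.

Theorem theorem12 (n : nat) (G : sgraph) (order_G : #|G| = n)
    (SP_G : SP_graph G) (min_degree_G : min_degree G = 2)
    (no_full_G : ~ exists x : G, full_vertex x) :
  L_SCC G = Infty \/ le_enat (L_SCC G) (Fin 5).
Proof.
have [n5|n5] := leqP n 5.
  (* Numbering the vertices moves the graph to ['I_n], where the tables apply. *)
  pose h : 'I_n -> G := enum_val \o cast_ord (esym order_G).
  have bh : bijective h.
    apply: inj_card_bij => [i j /enum_val_inj /cast_ord_inj //|].
    by rewrite card_ord order_G.
  apply: (@L_SCC_bound _ G (fun i j => adj (h i) (h j))); first by exists h.
  apply: SP_rel_small; last exact: all_small_graphs_ok.
    by move=> i j; apply: adj_sym.
  by move=> i; apply: adj_irrefl.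
have [x deg_x] : exists x : G, degree x = 2.
  case: (min_degree_attained G) => [|[x]]; rewrite min_degree_G; last by exists x.
  (* The neutral value of the minimum would give order 2, against [5 < n]. *)
  by move=> G2; move: n5; rewrite -order_G -G2.
apply: (@L_SCC_bound G G (@adj G)); first by exists id => //; exists id.
apply: (SP_rel_large (v := x)) => //; [exact: adj_sym | exact: adj_irrefl |].
by rewrite order_G.
Qed.
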